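(* Let $u_0\in BV(\mathbb{R})$, let $\Delta x>0$, and let $\{u_{j+\frac12}(t)\}_{j\in\mathbb{Z}}$, $t\in[0,T]$, be the family of solutions of the semidiscrete Lagrangian-Eulerian scheme (described in the context) with initial datum $u_0$, with associated step function $u^{\Delta x}$. Then there exists a continuous function $B$ such that $$TV(u^{\Delta x}(t))\le TV(u_0)+\frac1{\Delta x}\int_0^t B(s)\,ds$$ for all $t\in[0,T]$, where $TV(u^{\Delta x}(t))=\sum_{j}|u_{j+\frac12}(t)-u_{j-\frac12}(t)|$.
   Context: $k_L,k_R>0$ are constants with $k_L\neq k_R$; $k(x)=k_L$ for $x<0$ and $k(x)=k_R$ for $x>0$. The scheme approximates $\partial_tu+\partial_x(k(x)u(1-u))=0$, $u(0,x)=u_0(x)$. Semidiscrete Lagrangian-Eulerian scheme: for $\Delta x>0$ and $j\in\mathbb{Z}$ put $x_j=j\Delta x$, $x_{j+\frac12}=(j+\frac12)\Delta x$, $I_j=(x_j,x_{j+1})$, and $k_{j+\frac12}=k(x_{j+\frac12})$ (so $k_{j+\frac12}=k_L$ if $j\le -1$ and $k_{j+\frac12}=k_R$ if $j\ge 0$). The unknowns are functions $u_{j+\frac12}(t)$, $j\in\mathbb{Z}$. Define the slopes $$s_{j+\frac12}=\mathrm{minmod}\Big(\tfrac{u_{j+\frac12}-u_{j-\frac12}}{\Delta x},\tfrac{u_{j+\frac32}-u_{j-\frac12}}{2\Delta x},\tfrac{u_{j+\frac32}-u_{j+\frac12}}{\Delta x}\Big),$$ where $\mathrm{minmod}(a_1,a_2,a_3)=s\min_i|a_i|$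 if $\mathrm{sgn}(a_1)=\mathrm{sgn}(a_2)=\mathrm{sgn}(a_3)=s$, and $0$ otherwise. Put $u^-_j=u_{j-\frac12}+\frac{\Delta x}{4}s_{j-\frac12}$, $u^+_j=u_{j+\frac12}-\frac{\Delta x}{4}s_{j+\frac12}$, and $f_{j+\frac12}=k_{j+\frac12}(1-u_{j+\frac12})$. The coefficients $b_j=b_j(f_{j-\frac12},f_{j+\frac12})$ are given functions of the two values $f_{j-\frac12},f_{j+\frac12}$ satisfying $|f_{j-\frac12}+f_{j+\frac12}|\le b_j$; they are locally Lipschitz and bounded on bounded sets, uniformly in $j$. With $$\mathcal{G}_j(u,v)=\tfrac14\Big(b_j\,(u-v)+(f_{j-\frac12}+f_{j+\frac12})(u+v)\Big),$$ the scheme is the system of ODEs $$\frac{d}{dt}u_{j+\frac12}(t)=-\frac1{\Delta x}\Big(\mathcal{G}_{j+1}(u^-_{j+1}(t),u^+_{j+1}(t))-\mathcal{G}_j(u^-_j(t),u^+_j(t))\Big),\qquad u_{j+\frac12}(0)=\frac1{\Delta x}\int_{I_j}u_0(x)\,dx,\quad j\in\mathbb{Z}.$$ The associated step function is $u^{\Delta x}(t,x)=\sum_j u_{j+\frac12}(t)\mathbf{1}_{I_j}(x)$. Solutions on a time interval $[0,T]$ are understood in $C^1([0,T];L^1(\mathbb{R}))$. *)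

(* Defs.v *)
From HB Require Import structures.
From mathcomp Require Import all_boot all_order all_algebra.
From mathcomp Require Import all_classical all_reals all_analysis.

Set Implicit Arguments.
Unset Strict Implicit.
Unset Printing Implicit Defensive.

Import Order.TTheory GRing.Theory Num.Theory.
Import numFieldNormedType.Exports.

Local Open Scope classical_set_scope.
Local Open Scope ring_scope.

Section FunctionSpaces.
Variable R : realType.

Definition total_variation_line (v : R -> R) : \bar R :=
  ereal_sup [set total_variation p.1 p.2 v | p in [set p : R * R | p.1 <= p.2]].

(* A function in BV(R) is a class modulo equality almost everywhere: its total
   variation is the least one among its representatives. *)
Definition TV_line (w : R -> R) : \bar R :=
  ereal_inf [set total_variation_line v |
    v in [set v : R -> R | {ae (@lebesgue_measure R), forall x, v x = w x}]].

Definition BV_line (w : R -> R) : Prop :=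
  (@lebesgue_measure R).-integrable setT (EFin \o w) /\ (TV_line w < +oo)%E.

(* The derivative at [t] relative to [A], so one-sided at the end points when
   [A] is a closed interval. *)
Definition has_deriv_within (A : set R) (g : R -> R) (t l : R) : Prop :=
  (s - t)^-1 * (g s - g t) @[s --> within A t^'] --> l.

Definition L1_dist (v w : R -> R) : \bar R :=
  (\int[@lebesgue_measure R]_x `|v x - w x|%:E)%E.

(* [U] belongs to C^1([0, T]; L^1(R)), [V] being its derivative. *)
Definition C1_L1 (T : R) (U : R -> R -> R) : Prop :=
  exists V : R -> R -> R, forall t, t \in `[0, T] ->
    [/\ (@lebesgue_measure R).-integrable setT (EFin \o U t),
        (@lebesgue_measure R).-integrable setT (EFin \o V t),
        L1_dist (fun x => (s - t)^-1 * (U s x - U t x)) (V t)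
          @[s --> within `[0, T] t^'] --> 0%E
      & L1_dist (V s) (V t) @[s --> within `[0, T] (nbhs t)] --> 0%E].

End FunctionSpaces.

(* Quantities attached to the cell I_j or to its midpoint x_{j+1/2} are indexed
   by [j : int]; thus [w j] stands for u_{j+1/2}.  Quantities attached to the
   node x_j are also indexed by [j]. *)
Section Scheme.
Variable R : realType.
Implicit Types (kL kR dx T : R) (j : int) (w : int -> R).

(* The value at 0 is irrelevant: [kfun] is only evaluated at midpoints. *)
Definition kfun kL kR (x : R) : R := if x < 0 then kL else kR.

Definition node dx j : R := j%:~R * dx.

Definition midpoint dx j : R := (j%:~R + 2^-1) * dx.

Definition cell dx j : set R := `]node dx j, node dx (j + 1)[.

Definition minmod (a1 a2 a3 : R) : R :=
  if (Num.sg a1 == Num.sg a2) && (Num.sg a2 == Num.sg a3)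
  then Num.sg a1 * Num.min `|a1| (Num.min `|a2| `|a3|)
  else 0.

Definition slope dx w j : R :=
  minmod ((w j - w (j - 1)) / dx)
         ((w (j + 1) - w (j - 1)) / (2 * dx))
         ((w (j + 1) - w j) / dx).

Definition u_minus dx w j : R := w (j - 1) + dx / 4 * slope dx w (j - 1).

Definition u_plus dx w j : R := w j - dx / 4 * slope dx w j.

Definition fcoef kL kR dx w j : R :=
  kfun kL kR (midpoint dx j) * (1 - w j).

Definition admissible_b (b : int -> R -> R -> R) : Prop :=
  [/\ forall j p q, `|p + q| <= b j p q,
      forall A : set (R * R), bounded_set A ->
        exists L : R, forall j, L.-lipschitz_A (fun z : R * R => b j z.1 z.2)
    & forall A : set (R * R), bounded_set A ->
        exists M : R, forall j z, A z -> `|b j z.1 z.2| <= M].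

Definition num_flux (b : int -> R -> R -> R) kL kR dx w j (u v : R) : R :=
  let fl := fcoef kL kR dx w (j - 1) in
  let fr := fcoef kL kR dx w j in
  4^-1 * (b j fl fr * (u - v) + (fl + fr) * (u + v)).

Definition node_flux (b : int -> R -> R -> R) kL kR dx w j : R :=
  num_flux b kL kR dx w j (u_minus dx w j) (u_plus dx w j).

Definition scheme_rhs (b : int -> R -> R -> R) kL kR dx w j : R :=
  - (dx^-1 * (node_flux b kL kR dx w (j + 1) - node_flux b kL kR dx w j)).

(* The cells are pairwise disjoint, so at most one term of this sum is nonzero. *)
Definition step_fun dx w (x : R) : R :=
  \sum_(j \in [set: int]) w j * \1_(cell dx j) x.

Definition scheme_solution (b : int -> R -> R -> R) kL kR dx T
    (u0 : R -> R) (u : R -> int -> R) : Prop :=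
  [/\ C1_L1 T (fun t => step_fun dx (u t)),
      forall j, u 0 j = dx^-1 * \int[@lebesgue_measure R]_(x in cell dx j) u0 x
    & forall t j, t \in `[0, T] ->
        has_deriv_within `[0, T] (fun s => u s j) t
          (scheme_rhs b kL kR dx (u t) j)].

Definition TV_step w : \bar R :=
  (\esum_(j in [set: int]) `|w j - w (j - 1)|%:E)%E.

End Scheme.

(* Main.v *)
Require Import Defs.
From HB Require Import structures.
From mathcomp Require Import all_boot all_order all_algebra.
From mathcomp Require Import all_classical all_reals all_analysis.
From mathcomp Require Import measurable_realfun finmap zify ring lra.
Import Order.TTheory GRing.Theory Num.Theory.
Import numFieldNormedType.Exports.
Local Open Scope classical_set_scope.
Local Open Scope ring_scope.

(** A step function on the grid with values [w j] has L1 norm [dx] times the sum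
    of the [`|w j|], and its variation is at most twice that sum.  Hence, on a
    fixed grid, the variation is a Lipschitz functional for the L1 distance,
    with constant [2 / dx].  The solution is a C^1 curve in L1, so the L1
    norm of its velocity [V] is continuous on the compact interval from 0 to [T],
    hence bounded by some [C], and the variation grows at rate at most
    [2 C / dx].  The function [B] is the constant [2 C].

    The growth bound is [TV_step_le_of_L1_speed].  It does not differentiate the
    total variation, which is not smooth: for a given [t] and finitely many
    jumps, the signs of the jumps at time [t] turn the sum of their absolute
    values into a linear functional of the solution, which equals this sum at
    time [t] and is at most the corresponding sum at time 0.  The mean value
    theorem applies to this linear functional, whose derivative is a limit of
    difference quotients, controlled through [sum_derivatives_le_L1_norm] by the
    L1 speed.

    It remains to start the estimate, that is to see that taking averages on
    cells does not increase the variation ([TV_step_averages_le]).  With the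
    signs fixed, the variation of finitely many averages is linear in each of
    them, and a linear function of an average is at most its value at some
    point of the cell.  So the variation of the averages is at most the
    variation of the function along some increasing sequence of points.  The
    points can be taken outside any null set, so the bound holds for each
    representative of the class of [u0], hence for the infimum [TV_line]. *)

Set Implicit Arguments.
Unset Strict Implicit.
Unset Printing Implicit Defensive.

(** * Averages and total variation *)

Lemma sum_increments_le_total_variation (R : realType) (v : R -> R)
    (y : nat -> R) (n : nat) : {homo y : i j / (i <= j)%N >-> i <= j} ->
  ((\sum_(i < n) `|v (y i.+1) - v (y i)|)%:E
     <= total_variation (y 0%N) (y n) v)%E.
Proof.
move=> ymono; elim: n => [|n IHn].
  by rewrite big_ord0 total_variationxx.
rewrite big_ord_recr/= EFinD (@total_variationD _ _ _ (y n)) ?ymono//.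
by rewrite leeD// total_variation_ge// ymono.
Qed.

(** Summation by parts: up to the boundary term on the right, the sum on the left
    is the sum of the nonpositive numbers [(tau i - tau i.+1) * d i]. *)
Lemma sum_mul_diff_le (R : realType) (tau d : nat -> R) (n : nat) :
  tau 0%N = 0 -> (forall i, (tau i - tau i.+1) * d i <= 0) ->
  \sum_(i < n) tau i.+1 * (d i.+1 - d i) <= tau n * d n.
Proof.
move=> tau0 htau; elim: n => [|n IHn]; first by rewrite big_ord0 tau0 mul0r.
rewrite big_ord_recr/=; have htaun := htau n; nra.
Qed.

(** The hypothesis is what an average [a i] of [v] over the cell [Q i] satisfies:
    it lies between the bounds of [v] there.  Once the signs of the increments
    of [a] are fixed, the sum on the left is linear in each [a i], with some
    coefficient [c], and [a i] can be replaced by a value of [v] that does not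
    decrease the sum. *)
Lemma sum_increments_averages_le (R : realType) (v : R -> R) (a : nat -> R)
    (Q : nat -> R -> Prop) (n : nat) :
  (forall i c, exists2 y, Q i y & c * a i <= c * v y) ->
  exists2 y : nat -> R, (forall i, Q i (y i)) &
    \sum_(i < n) `|a i.+1 - a i| <= \sum_(i < n) `|v (y i.+1) - v (y i)|.
Proof.
move=> hQ.
(* [tau i.+1] is the sign of the increment from [i] to [i.+1]; it vanishes at
   both ends of the window, so the coefficient of [a i] in the sum of the
   increments is [tau i - tau i.+1], also at the end points. *)
pose tau i : R :=
  if i is i'.+1 then if (i' < n)%N then Num.sg (a i - a i') else 0 else 0.
have /choice[y hy] (i : nat) : exists y,
    Q i y /\ (tau i - tau i.+1) * a i <= (tau i - tau i.+1) * v y.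
  by have [y ? ?] := hQ i (tau i - tau i.+1); exists y.
exists y => [i|]; first by have [] := hy i.
have := @sum_mul_diff_le _ tau (fun i => a i - v (y i)) n.+1 erefl.
rewrite big_ord_recr/= ltnn !mul0r addr0 => /(_ _)/wrap[i|le0].
  by have [_] := hy i; rewrite mulrBr subr_le0.
apply: le_trans (_ : \sum_(i < n) tau i.+1 * (v (y i.+1) - v (y i)) <= _).
  rewrite -subr_le0 -sumrB; apply: le_trans le0.
  apply: ler_sum => i _; rewrite /tau ltn_ord.
  rewrite normrEsg le_eqVlt -mulrBr; apply/orP; left; apply/eqP; ring.
apply: ler_sum => i _; apply: le_trans (ler_norm _) _.
rewrite normrM -[leRHS]mul1r ler_wpM2r// /tau ltn_ord.
by rewrite normr_sg lern1 leq_b1.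
Qed.

(** Were [f] below its average [c] at almost every point of [A], the function
    [c - f], whose integral over [A] is 0, would be positive almost
    everywhere. *)
Lemma exists_ge_average (d : measure_display) (T : measurableType d)
    (R : realType) (mu : {measure set T -> \bar R}) (A : set T) (m : R)
    (f : T -> R) (P : T -> Prop) :
  measurable A -> mu A = m%:E -> 0 < m ->
  mu.-integrable A (EFin \o f) -> {ae mu, forall x, P x} ->
  exists2 y, A y /\ P y & m^-1 * \int[mu]_(x in A) f x <= f y.
Proof.
move=> mA muA m0 fint aeP; set c := _ * _.
apply: contrapT => noy.
have lt_c x : A x -> P x -> f x < c.
  move=> Ax Px; rewrite ltNge; apply/negP => cf; apply: noy.
  by exists x.
have cint : mu.-integrable A (EFin \o cst c).
  apply/integrableP; split; first exact/measurable_EFinP.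
  rewrite (eq_integral (cst `|c|%:E))// integral_cst//= muA -EFinM ltry//.

pose g : T -> \bar R := fun x => (c - f x)%:E.
have gint : mu.-integrable A g.
  have := integrableB mA cint fint; apply: eq_integrable => //.
have mg := measurable_int _ gint.
have ig0 : (\int[mu]_(x in A) g x = 0)%E.
  rewrite -[LHS]fineK; last exact: integrable_fin_num.
  rewrite -[fine _]/(\int[mu]_(x in A) (c - f x))%R RintegralB//.
  by rewrite Rintegral_cst// muA /= /c mulrAC mulVf ?mul1r ?subrr// gt_eqF.
have aeg : ae_eq mu A g (cst 0%E).
  apply/ae_eq_integral_abs => //; rewrite -[RHS]ig0.
  apply: ae_eq_integral => //; first exact: measurableT_comp.
  apply: filterS aeP => x Px Ax; rewrite /g gee0_abs// lee_fin subr_ge0.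
  exact/ltW/lt_c.
have : mu.-negligible A.
  apply: negligibleS (filterI aeP aeg) => x Ax /= -[Px /(_ Ax)[]] /eqP.
  by rewrite subr_eq0 => /eqP cf; have := lt_c _ Ax Px; rewrite cf ltxx.
move=> /(measure_negligible mA) => muA0.
have : m%:E = 0%E by rewrite -muA.
by move=> [] /eqP; rewrite gt_eqF.
Qed.

Lemma measurable_cell (R : realType) (dx : R) (j : int) :
  measurable (cell dx j : set (measurableTypeR R)).
Proof. exact: measurable_itv. Qed.

Lemma node_succ (R : realType) (dx : R) (j : int) :
  node dx (j + 1) = node dx j + dx.
Proof. by rewrite /node intrD mulrDl mul1r. Qed.

Lemma le_node (R : realType) (dx : R) (i j : int) :
  0 <= dx -> i <= j -> node dx i <= node dx j.
Proof. by move=> dx0 ij; rewrite ler_wpM2r// ler_int. Qed.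

Lemma lebesgue_measure_cell (R : realType) (dx : R) (j : int) :
  0 < dx -> lebesgue_measure (cell dx j) = dx%:E.
Proof.
move=> dx0; rewrite /cell lebesgue_measure_itv/= lte_fin node_succ ltrDl dx0.
by rewrite -EFinD addrAC subrr add0r.
Qed.

Lemma lt_of_cells (R : realType) (dx x y : R) (i j : int) :
  0 < dx -> i < j -> cell dx i x -> cell dx j y -> x < y.
Proof.
rewrite /cell /= !in_itv/= => dx0 ij /andP[_ xi] /andP[jy _].
apply: lt_trans jy; apply: (lt_le_trans xi); apply: le_node; first exact: ltW.
by rewrite addrC lez1D.
Qed.

(** Brings the finite sums of [TV_step], over sets of integers, to sums over
    consecutive cells, which can be numbered by [nat]. *)
Lemma fsum_int_le_window (R : realType) (G : int -> R) (A : set int) :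
  finite_set A -> (forall j, 0 <= G j) ->
  exists N n : nat,
    (\sum_(j \in A) (G j)%:E <= (\sum_(i < n) G (i%:Z - N%:Z))%:E)%E.
Proof.
move=> finA G0; pose N := \max_(j <- fset_set A) `|j|%N.
exists N, (N + N).+1; pose h (i : nat) : int := i%:Z - N%:Z.
have hinj : set_inj `I_(N + N).+1 h.
  by move=> i k _ _ /addIr [].
rewrite -sumEFin (fsbig_ord _ _ (fun i => (G (h i))%:E)).
rewrite -(fsbig_image _ _ (fun j => (G j)%:E) hinj).
apply: lee_fsum_nneg_subset => //.
- exact/finite_image/finite_II.
- move=> j jA; apply/mem_set.
  have jN : (`|j| <= N)%N.
    by apply: (@leq_bigmax_seq _ _ xpredT (fun j : int => `|j|%N));
      rewrite ?in_fset_set.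
  exists (absz ((j : int) + N%:Z)); rewrite /= /h; move: j jN {jA} => /= j; lia.
- by move=> j _; rewrite lee_fin.
Qed.

(** Averaging over cells does not increase the variation.  The averages are
    those of [u0], whereas the variation is that of a representative [v]; the
    points that replace the averages are therefore chosen where [v] agrees with
    [u0]. *)
Lemma TV_step_averages_le (R : realType) (u0 : R -> R) (dx : R) (w : int -> R) :
  0 < dx -> (@lebesgue_measure R).-integrable setT (EFin \o u0) ->
  (forall j, w j = dx^-1 * \int[@lebesgue_measure R]_(x in cell dx j) u0 x) ->
  (TV_step w <= TV_line u0)%E.
Proof.
move=> dx0 u0int hw; apply: le_ereal_inf_tmp => _ [v vu0 <-].
apply: ge_ereal_sup => _ [A [finA _] <-].
have [N [n /le_trans]] := 
  fsum_int_le_window finA (fun j => normr_ge0 (w j - w (j - 1))).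
apply; pose p (i : nat) : int := i%:Z - N%:Z - 1.
have sel i c : exists2 y, cell dx (p i) y & c * w (p i) <= c * v y.
  have u0i : lebesgue_measure.-integrable (cell dx (p i)) (EFin \o u0).
    by apply: (integrableS _ (measurable_cell dx (p i)) _ u0int).
  have cu0i : lebesgue_measure.-integrable (cell dx (p i))
      (EFin \o (fun x => c * u0 x)).
    have := integrableZl (measurable_cell dx (p i)) c u0i.
    by apply: (eq_integrable (measurable_cell dx (p i))).
  have [y [cy vy] avg] := exists_ge_average (measurable_cell dx (p i))
    (lebesgue_measure_cell (p i) dx0) dx0 cu0i vu0.
  exists y => //; move: avg.
  by rewrite (RintegralZl c (measurable_cell dx (p i)))// mulrCA -hw vy.
have [y yc] := sum_increments_averages_le n sel.
have pS i : p i.+1 = i%:Z - N%:Z by rewrite /p; lia.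
rewrite -lee_fin => /(le_trans _) hy; apply: le_trans (hy _ _) _.
  by rewrite lee_fin; apply: ler_sum => i _; rewrite /= pS.
have ymono : {homo y : i j / (i <= j)%N >-> i <= j}.
  move=> i j; rewrite leq_eqVlt => /predU1P[->//|ij]; apply/ltW.
  by apply: lt_of_cells dx0 _ (yc i) (yc j); rewrite /p; lia.
apply: le_trans (sum_increments_le_total_variation v n ymono) _.
by apply: ereal_sup_ubound; exists (y 0%N, y n) => //=; exact: ymono.
Qed.

(** * Step functions in L1 *)

Lemma cell_inj (R : realType) (dx x : R) (i j : int) :
  0 < dx -> cell dx i x -> cell dx j x -> i = j.
Proof.
move=> dx0 xi xj; case: (ltgtP i j) => // ij.
- by have := lt_of_cells dx0 ij xi xj; rewrite ltxx.
- by have := lt_of_cells dx0 ij xj xi; rewrite ltxx.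
Qed.

Lemma step_fun_cell (R : realType) (dx x : R) (w : int -> R) (j : int) :
  0 < dx -> cell dx j x -> step_fun dx w x = w j.
Proof.
move=> dx0 xj; rewrite /step_fun (@fsbigTE _ _ _ _ [fset j]%fset) => [|i].
  by rewrite big_seq_fset1 indicE mem_set// mulr1.
rewrite inE => ij; rewrite indicE memNset ?mulr0// => xi.
by move: ij; rewrite (cell_inj dx0 xi xj) eqxx.
Qed.

Definition L1_norm (R : realType) (f : R -> R) : R :=
  \int[@lebesgue_measure R]_x `|f x|.

(** Stated for a function [g] equal to [q j] on the [j]-th cell rather than for
    [step_fun dx q], so as to apply to difference quotients of step functions
    without expressing them as step functions. *)
Lemma sum_cells_le_L1_norm (R : realType) (dx : R) (g : R -> R) (q : int -> R)
    (s : seq int) :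
  0 < dx -> uniq s -> (@lebesgue_measure R).-integrable setT (EFin \o g) ->
  (forall j x, cell dx j x -> g x = q j) ->
  dx * \sum_(j <- s) `|q j| <= L1_norm g.
Proof.
move=> dx0 us gint gq.
have ngint : (@lebesgue_measure R).-integrable setT (fun x => `|g x|%:E).
  exact: integrable_norm gint.
rewrite -lee_fin /L1_norm /Rintegral fineK; last exact: integrable_fin_num.
have mcells : measurable
    (\big[setU/set0]_(j <- s) cell dx j : set (measurableTypeR R)).
  by apply: bigsetU_measurable => j _; exact: measurable_cell.
have mng := measurable_int _ ngint.
apply: le_trans (ge0_subset_integral _ mcells _ mng _ _) => //.
rewrite ge0_integral_bigsetU//=.
- rewrite mulr_sumr -sumEFin; apply: lee_sum => j _.
  rewrite (eq_integral (fun=> `|q j|%:E)) => [|x /set_mem /gq ->//].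
  rewrite integral_cst//; last exact: measurable_cell.
  by rewrite [X in (_ * X)%E](lebesgue_measure_cell j dx0) -EFinM mulrC.
- by move=> j; exact: measurable_cell.
- by move=> i j _ _ [x [xi xj]]; exact: cell_inj xi xj.
- exact: measurable_funS mng.
Qed.

Lemma L1_norm_le (R : realType) (f g : R -> R) :
  (@lebesgue_measure R).-integrable setT (EFin \o f) ->
  (@lebesgue_measure R).-integrable setT (EFin \o g) ->
  L1_norm f <= L1_norm g + fine (L1_dist f g).
Proof.
move=> fint gint.
have fgint : (@lebesgue_measure R).-integrable setT
    (EFin \o (fun x => f x - g x)).
  exact: (integrableB _ fint gint).
have hf : (@lebesgue_measure R).-integrable setT (fun x => `|f x|%:E).
  exact: integrable_norm fint.
have hg : (@lebesgue_measure R).-integrable setT (fun x => `|g x|%:E).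
  exact: integrable_norm gint.
have hfg : (@lebesgue_measure R).-integrable setT (fun x => `|f x - g x|%:E).
  exact: integrable_norm fgint.
rewrite -[fine _]/(\int[@lebesgue_measure R]_x `|f x - g x|) -RintegralD//.
apply: le_Rintegral => //.
  exact: (integrableD _ hg hfg).
by move=> x _; rewrite -{1}(subrK (g x) (f x)) addrC ler_normD.
Qed.

Lemma L1_distC (R : realType) (f g : R -> R) : L1_dist f g = L1_dist g f.
Proof. by apply: eq_integral => x _; rewrite distrC. Qed.

(** * Derivatives relative to a set *)

(** Limits along [within `[0, T] t^'] preserve inequalities because every point
    of the interval, end points included, is a limit of other points of it. *)
Lemma within_itv_dnbhs_proper (R : realType) (T t : R) :
  0 < T -> t \in `[0, T] -> ProperFilter (within `[0, T] t^').
Proof.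
move=> T0; rewrite in_itv/= => /andP[t0 tT]; apply: Build_ProperFilter_ex => P.
rewrite /within /dnbhs /= => /nbhs_ballP[e /= e0 heP].
have [tltT|Tlet] := ltP t T.
- pose x := t + Num.min (e / 2) (T - t).
  have m0 : 0 < Num.min (e / 2) (T - t) by rewrite lt_min divr_gt0//= subr_gt0.
  have [me mT] : Num.min (e / 2) (T - t) <= e / 2 /\
    Num.min (e / 2) (T - t) <= T - t by rewrite !ge_min !lexx orbT.
  exists x; apply: heP.
  + by rewrite /ball/= /x opprD addrA subrr sub0r normrN gtr0_norm//; lra.
  + by rewrite /x; apply/eqP; lra.
  + by rewrite /= in_itv/= /x; lra.
- pose x := t - Num.min (e / 2) t.
  have tp : 0 < t by exact: lt_le_trans Tlet.
  have m0 : 0 < Num.min (e / 2) t by rewrite lt_min divr_gt0//=.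
  have [me mT] : Num.min (e / 2) t <= e / 2 /\ Num.min (e / 2) t <= t.
    by rewrite !ge_min !lexx orbT.
  exists x; apply: heP.
  + by rewrite /ball/= /x opprB addrC subrK gtr0_norm//; lra.
  + by rewrite /x; apply/eqP; lra.
  + by rewrite /= in_itv/= /x; lra.
Qed.

Section derivative_within.
Variable R : realType.
Implicit Types (A : set R) (g : R -> R) (t l : R).

Lemma has_deriv_within_continuous A g t l :
  has_deriv_within A g t l -> g s @[s --> within A (nbhs t)] --> g t.
Proof.
move=> dg.
have {dg} : g s @[s --> within A t^'] --> g t.
  have st0 : s - t @[s --> within A t^'] --> (0 : R).
    suff st0 : s - t @[s --> t] --> (0 : R).
      move=> P /st0 hP.
      have {}hP : \forall s \near t, P (s - t) by exact: hP.
      have : \forall s \near t, s != t -> A s -> P (s - t).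
        by move: hP; apply: filterS => s hs _ _.
      by [].
    have : s - t @[s --> t] --> (t - t : R).
      by apply: cvgB; [exact: cvg_id|exact: cvg_cst].
    by rewrite subrr.
  have := cvgD (cvgM st0 dg) (cvg_cst (g t)); rewrite mul0r add0r.
  move=> cg P /cg hP.
  have {}hP : \forall s \near t, s != t -> A s ->
    P ((s - t) * ((s - t)^-1 * (g s - g t)) + g t) by exact: hP.
  suff : \forall s \near t, s != t -> A s -> P (g s) by [].
  move: hP; apply: filterS => s hs st As; have := hs st As.
  by rewrite mulrA mulfV ?mul1r ?subrK// subr_eq0.
move=> cg P Pgt.
have : \forall s \near t, s != t -> A s -> P (g s) by exact: cg _ Pgt.
suff : (\forall s \near t, s != t -> A s -> P (g s)) ->
  \forall s \near t, A s -> P (g s) by [].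
apply: filterS => s hs As.
by have [->|st] := eqVneq s t; [exact: nbhs_singleton|exact: hs].
Qed.

Lemma has_deriv_within_is_derive A g t l :
  A° t -> has_deriv_within A g t l -> is_derive t 1 g l.
Proof.
move=> At dg.
suff cv : h^-1 *: ((g \o shift t) (h *: (1 : R)) - g t) @[h --> 0^'] --> l.
  by apply: DeriveDef; [apply/cvg_ex; exists l | exact: cvg_lim].
move=> P /dg hP.
have {}hP : \forall s \near t, s != t -> A s -> P ((s - t)^-1 * (g s - g t)).
  by [].
suff : \forall h \near (0 : R), h != 0 ->
  P (h^-1 *: ((g \o shift t) (h *: (1 : R)) - g t)) by [].
have : \forall s \near t,
    A s /\ (s != t -> A s -> P ((s - t)^-1 * (g s - g t))).
  exact: filterI At hP.
rewrite (near_shift 0); apply: filterS => h /=; rewrite subr0 => -[Ah hh] h0.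
have := hh _ Ah; rewrite -subr_eq0 addrK => /(_ h0).
by rewrite /GRing.scale/= mulr1.
Qed.

Lemma has_deriv_within_sum A t (I : Type) (s : seq I) (g : I -> R -> R)
    (l : I -> R) :
  (forall i, has_deriv_within A (g i) t (l i)) ->
  has_deriv_within A (fun x => \sum_(i <- s) g i x) t (\sum_(i <- s) l i).
Proof.
move=> dg; rewrite /has_deriv_within.
under eq_fun do rewrite -sumrB mulr_sumr.
apply: cvg_big => [|i _]; last exact: dg.
exact: (@pseudometric_normed_Zmodule.add_continuous R R).
Qed.

(** Mean value inequality; at the end points the one-sided derivatives serve only
    to provide continuity. *)
Lemma le_of_deriv_within_le (h dh : R -> R) (T C t : R) :
  (forall s, s \in `[0, T] -> has_deriv_within `[0, T] h s (dh s)) ->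
  (forall s, s \in `[0, T] -> dh s <= C) ->
  t \in `[0, T] -> h t <= h 0 + C * t.
Proof.
move=> hd dhC; rewrite in_itv/= => /andP[t0 tT].
have sub s : s \in `[0, t] -> s \in `[0, T].
  by rewrite !in_itv/= => /andP[-> /le_trans->].
have [//|s||c /sub cT] := @MVT_segment _ h dh 0 t.
- move=> st; apply: (@has_deriv_within_is_derive `[0, T]); last first.
    by apply/hd/sub; exact: subset_itv_oo_cc st.
  rewrite interior_itv_bnd /= in_itv/=.
  by move: st; rewrite in_itv/= => /andP[-> /lt_le_trans->].
- apply/subspace_continuousP => s st.
  move=> P /(has_deriv_within_continuous (hd s (sub _ st))) hP.
  have {}hP : \forall x \near s, x \in `[0, T] -> P (h x) by exact: hP.
  suff : \forall x \near s, x \in `[0, t] -> P (h x) by [].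
  by move: hP; apply: filterS => x hx /sub.
- rewrite subr0 => /eqP; rewrite subr_eq => /eqP ->.
  by rewrite addrC lerD2l ler_wpM2r// dhC.
Qed.

End derivative_within.

(** * Evolution of the total variation *)

(** The L1 norm is 1-Lipschitz for the L1 distance, so it is continuous along [V]
    and attains its maximum over the segment. *)
Lemma L1_norm_bounded (R : realType) (T : R) (V : R -> R -> R) :
  0 < T ->
  (forall t, t \in `[0, T] ->
     (@lebesgue_measure R).-integrable setT (EFin \o V t)) ->
  (forall t, t \in `[0, T] ->
     L1_dist (V s) (V t) @[s --> within `[0, T] (nbhs t)] --> 0%E) ->
  exists C, forall t, t \in `[0, T] -> L1_norm (V t) <= C.
Proof.
move=> T0 Vint Vcont.
suff cN : {within `[0, T], continuous (fun t => L1_norm (V t))}.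
  by have [c _ hc] := EVT_max (ltW T0) cN; exists (L1_norm (V c)).
apply/subspace_continuousP => t /= tT; apply/cvgrPdist_lt => e e0.
have /fine_cvgP[_ /cvgrPdist_lt/(_ e e0) hd] := Vcont t tT.
have {}hd : \forall s \near t, s \in `[0, T] ->
  `|0 - fine (L1_dist (V s) (V t))| < e by exact: hd.
suff : \forall s \near t, s \in `[0, T] ->
  `|L1_norm (V t) - L1_norm (V s)| < e by [].
move: hd; apply: filterS => s hd sT.
have := hd sT; rewrite sub0r normrN => /(le_lt_trans (ler_norm _)).
have := L1_norm_le (Vint _ sT) (Vint _ tT).
have := L1_norm_le (Vint _ tT) (Vint _ sT).
by rewrite (L1_distC (V t)) ltr_norml => ? ? ?; lra.
Qed.

(** For difference quotients in place of derivatives, the sum on the left is at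
    most the L1 norm of the difference quotient of the step functions, which
    tends to the L1 norm of [V].  Since the sum is finite, it passes to the limit
    term by term; this avoids identifying [V] with a step function. *)
Lemma sum_derivatives_le_L1_norm (R : realType) (dx T t : R)
    (u : R -> int -> R) (V : R -> R) (r : int -> R) (l : seq int) :
  0 < dx -> 0 < T -> t \in `[0, T] ->
  (forall s, s \in `[0, T] ->
     (@lebesgue_measure R).-integrable setT (EFin \o step_fun dx (u s))) ->
  (@lebesgue_measure R).-integrable setT (EFin \o V) ->
  L1_dist (fun x => (s - t)^-1 * (step_fun dx (u s) x - step_fun dx (u t) x)) V
    @[s --> within `[0, T] t^'] --> 0%E ->
  (forall j, has_deriv_within `[0, T] (fun s => u s j) t (r j)) ->
  uniq l -> dx * \sum_(j <- l) `|r j| <= L1_norm V.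
Proof.
move=> dx0 T0 tT uint Vint dU du ul.
have PF := within_itv_dnbhs_proper T0 tT.
have cf : dx * \sum_(j <- l) `|(s - t)^-1 * (u s j - u t j)|
    @[s --> within `[0, T] t^'] --> dx * \sum_(j <- l) `|r j|.
  apply: cvgM; first exact: cvg_cst.
  apply: cvg_big => [|j _]; last by apply: cvg_norm; exact: du.
  exact: (@pseudometric_normed_Zmodule.add_continuous R R).
have /fine_cvgP[_ cd] := dU.
have cg : L1_norm V + fine (L1_dist
    (fun x => (s - t)^-1 * (step_fun dx (u s) x - step_fun dx (u t) x)) V)
    @[s --> within `[0, T] t^'] --> L1_norm V.
  have := cvgD (cvg_cst (L1_norm V)) cd; rewrite addr0; exact.
apply: (ler_cvg_to cf cg (Fa := PF)).
suff : \forall s \near t, s != t -> s \in `[0, T] ->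
  dx * \sum_(j <- l) `|(s - t)^-1 * (u s j - u t j)| <= L1_norm V +
  fine (L1_dist
    (fun x => (s - t)^-1 * (step_fun dx (u s) x - step_fun dx (u t) x)) V).
  by [].
apply: (@nearW _ (nbhs t)) => s st sT.
have qint : (@lebesgue_measure R).-integrable setT
    (EFin \o (fun x =>
      (s - t)^-1 * (step_fun dx (u s) x - step_fun dx (u t) x))).
  apply: (integrableZl _ _ (integrableB _ (uint s sT) (uint t tT))) => //.
apply: le_trans (L1_norm_le qint Vint).
apply: sum_cells_le_L1_norm => // j x xj.
by rewrite !(step_fun_cell _ dx0 xj).
Qed.

(** The signs [sigma j] of the jumps at the final time [t] are kept
    at all times: the linear functional [h] so obtained is differentiable,
    equals the sum of the absolute values of the jumps at time [t], and is at
    most that sum at time 0. *)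
Lemma TV_step_le_of_L1_speed (R : realType) (dx T C : R) (u r : R -> int -> R) :
  0 < dx ->
  (forall t j, t \in `[0, T] ->
     has_deriv_within `[0, T] (fun s => u s j) t (r t j)) ->
  (forall t l, t \in `[0, T] -> uniq l -> dx * \sum_(j <- l) `|r t j| <= C) ->
  forall t, t \in `[0, T] ->
    (TV_step (u t) <= TV_step (u 0%R) + (dx^-1 * (2 * C * t))%:E)%E.
Proof.
move=> dx0 du rC t tT; apply: ge_ereal_sup => _ [A [finA _] <-].
rewrite fsumEFin// fsbig_finite//=; set l := enum_fset _.
have ul : uniq l by exact: fset_uniq.
pose sigma j := Num.sg (u t j - u t (j - 1)).
pose h s := \sum_(j <- l) sigma j * (u s j - u s (j - 1)).
pose dh s := \sum_(j <- l) sigma j * (r s j - r s (j - 1)).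
have sigma_le j x : sigma j * x <= `|x|.
  apply: le_trans (ler_norm _) _; rewrite normrM normr_sg -[leRHS]mul1r.
  by rewrite ler_wpM2r// lern1 leq_b1.
have hd s : s \in `[0, T] -> has_deriv_within `[0, T] h s (dh s).
  move=> sT; apply: has_deriv_within_sum => j; rewrite /has_deriv_within.
  rewrite [X in X @ _ --> _](_ : _ = fun x =>
      sigma j * ((x - s)^-1 * (u x j - u s j)
                 - (x - s)^-1 * (u x (j - 1) - u s (j - 1)))).
    apply: cvgM; first exact: cvg_cst.
    by apply: cvgB; exact: du.
  by apply/funext => x; ring.
have dhC s : s \in `[0, T] -> dh s <= dx^-1 * (2 * C).
  move=> sT; rewrite -(ler_pM2l dx0) mulrA mulfV ?mul1r ?gt_eqF//.
  apply: le_trans (_ : dx * (\sum_(j <- l) `|r s j|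
     + \sum_(j <- [seq j - 1 | j <- l]) `|r s j|) <= _).
    rewrite ler_pM2l// big_map -big_split/=; apply: ler_sum => j _.
    by apply: le_trans (sigma_le _ _) _; exact: ler_normB.
  have ul1 : uniq [seq j - 1 | j <- l] by rewrite map_inj_uniq//; exact: addIr.
  have := rC s _ sT ul; have := rC s _ sT ul1; lra.
have := le_of_deriv_within_le hd dhC tT.
rewrite -lee_fin EFinD -(mulrA _ (2 * C) t) => ht.
apply: le_trans (_ : _ <= (h t)%:E)%E _.
  by rewrite lee_fin; apply: ler_sum => j _; rewrite normrEsg.
apply: (le_trans ht); apply: leeD => //.
apply: (@le_trans _ _ (\sum_(j \in A) `|u 0%R j - u 0%R (j - 1)|%:E)%E).
  rewrite fsumEFin// fsbig_finite//= lee_fin; apply: ler_sum => j _.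
  exact: sigma_le.
by apply: ereal_sup_ubound; exists A.
Qed.

Unset Implicit Arguments.

Theorem proposition3p4 (R : realType) (kL kR : R) (b : int -> R -> R -> R)
    (u0 : R -> R) (dx T : R) (u : R -> int -> R)
    (hkL : 0 < kL) (hkR : 0 < kR) (hk : kL != kR)
    (hb : admissible_b b)
    (hu0 : BV_line u0) (hdx : 0 < dx) (hT : 0 < T)
    (hu : scheme_solution b kL kR dx T u0 u) :
  exists B : R -> R,
    {within `[0, T], continuous B} /\
    forall t, t \in `[0, T] ->
      (TV_step (u t) <=
       TV_line u0
       + (dx^-1 * \int[@lebesgue_measure R]_(s in `[0, t]) B s)%:E)%E.
Proof.
have [[V hV] u_init du] := hu.
have [C VC] : exists C, forall t, t \in `[0, T] -> L1_norm (V t) <= C.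
  by apply: (L1_norm_bounded hT) => t /hV[].
exists (cst (2 * C)); split=> [|t tT]; first exact: cst_continuous.
have -> : \int[@lebesgue_measure R]_(s in `[0, t]) cst (2 * C) s = 2 * C * t.
  rewrite Rintegral_cst//= lebesgue_measure_itv/= lte_fin.
  move: tT; rewrite in_itv/= => /andP[].
  by rewrite le_eqVlt => /predU1P[<-|->]; rewrite ?ltxx ?oppr0 ?addr0.
have [u0int _] := hu0.
apply: (@le_trans _ _ (TV_step (u 0%R) + (dx^-1 * (2 * C * t))%:E)%E).
  apply: (TV_step_le_of_L1_speed hdx du _ tT) => s l sT ul.
  have [_ Vint dU _] := hV s sT.
  apply: le_trans _ (VC s sT).
  apply: (sum_derivatives_le_L1_norm hdx hT sT _ Vint dU _ ul) => [s' /hV[]|j] //.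
  exact: du.
by rewrite leeD2r//; exact: TV_step_averages_le hdx u0int u_init.
Qed.
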